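(* Let $(X_n)$ be a sequence of finite sets and let $(\mathcal{F}_n)$ be a sequence of nontrivial upper sets $\mathcal{F}_n \subseteq 2^{X_n}$. Let $K>0$ be a constant such that $p_c(\mathcal{F}_n)\leq K q(\mathcal{F}_n)\log \ell(\mathcal{F}_n)$ for all $n$. Suppose $\ell(\mathcal{F}_n)\to\infty$ and that the Kahn-Kalai bounds provide nontrivial information for $(\mathcal{F}_n)$. Then for every fixed integer $t\geq 0$ there exists $N$ such that for all $n\geq N$, $\sigma_{|(\mathcal{F}_n)_0|-t}\big(S : S\in(\mathcal{F}_n)_0\big)=\emptyset$; that is, the intersection of all but any $t$ of the minimal elements of $\mathcal{F}_n$ is eventually empty.
   Context: For a finite set $X$, an upper set is a subset $\mathcal{F}\subseteq 2^X$ such that $A\in\mathcal{F}$ and $A\subseteq B\subseteq X$ imply $B\in\mathcal{F}$; it is nontrivial if $\mathcal{F}\neq\emptyset$ and $\mathcal{F}\neq 2^X$. For $p\in[0,1]$ let $\mu_p(\mathcal{F})=\sum_{S\in\mathcal{F}}p^{|S|}(1-p)^{|X|-|S|}$; for nontrivial $\mathcal{F}$, the critical probability $p_c(\mathcal{F})$ is the unique $p\in[0,1]$ with $\mu_p(\mathcal{F})=\frac12$. For $S\subseteq X$ let $\langle S\rangle=\{T\subseteq X: S\subseteq T\}$. A set $\mathcal{G}\subseteq 2^X$ is a cover of $\mathcal{F}$ if $\mathcal{F}\subseteq\bigcup_{S\in\mathcal{G}}\langle S\rangle$. $\mathcal{F}$ is $p$-small if it has a cover $\mathcal{G}$ with $\sum_{S\in\mathcal{G}}p^{|S|}\leq\frac12$.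 The expectation threshold $q(\mathcal{F})$ is the largest $p\in[0,1]$ for which $\mathcal{F}$ is $p$-small. $\mathcal{F}_0$ denotes the set of (inclusion-)minimal elements of $\mathcal{F}$, $\ell_0(\mathcal{F})=\max\{|S|:S\in\mathcal{F}_0\}$ and $\ell(\mathcal{F})=\max\{\ell_0(\mathcal{F}),2\}$. $\log$ is the logarithm to base 2. The Kahn-Kalai bounds provide nontrivial information for $(\mathcal{F}_n)$ if there exists $N$ such that $Kq(\mathcal{F}_n)\log\ell(\mathcal{F}_n)<1$ for all $n\geq N$. For subsets $S_1,\dots,S_m$ of $X$ and an integer $k$, $\sigma_k(S_1,\dots,S_m)=\bigcup_{I\subseteq\{1,\dots,m\},\ |I|=k}\big(\bigcap_{i\in I}S_i\big)$ (the lattice-theoretic elementary symmetric polynomial), with the empty intersection equal to $X$ and the empty union equal to $\emptyset$. *)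

(* Defs.v *)
From mathcomp Require Import all_boot all_order all_algebra.
From mathcomp Require Import boolp classical_sets reals topology normedtype.
From mathcomp Require Import sequences derive exp.
(* Re-imported so that set0, setT, bigcup, ... denote finite sets by default;
   sets of reals are written with the %classic delimiter. *)
From mathcomp Require Import finset.

Set Implicit Arguments.
Unset Strict Implicit.
Unset Printing Implicit Defensive.

Import Order.TTheory GRing.Theory Num.Theory.
Import numFieldNormedType.Exports.

Local Open Scope ring_scope.

Section UpperSets.
Variable T : finType.
Implicit Types (F G : {set {set T}}) (S : {set T}).

Definition upper_set F : Prop :=
  forall A B : {set T}, A \in F -> A \subset B -> B \in F.

Definition nontrivial F : Prop := F <> set0 /\ F <> setT.

Definition principal S : {set {set T}} :=
  [set B : {set T} | S \subset B].

Definition covers G F : Prop :=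
  F \subset \bigcup_(S in G) principal S.

Definition minimals F : {set {set T}} := [set S | minset (mem F) S].

Definition ell0 F : nat := \max_(S in minimals F) #|S|.

Definition ell F : nat := maxn (ell0 F) 2.

(* k is an integer: for k < 0 there is no index set of cardinal k, so that
   sigma k A is the empty union, whereas sigma 0 A is the whole of T. *)
Definition sigma (m : nat) (k : int) (A : 'I_m -> {set T}) : {set T} :=
  \bigcup_(I : {set 'I_m} | #|I|%:Z == k) \bigcap_(i in I) A i.

End UpperSets.

Section Thresholds.
Variable R : realType.

Definition mu (T : finType) (p : R) (F : {set {set T}}) : R :=
  \sum_(S in F) p ^+ #|S| * (1 - p) ^+ (#|T| - #|S|).

Definition is_critical (T : finType) (F : {set {set T}}) (p : R) : Prop :=
  0 <= p <= 1 /\ mu p F = 2^-1.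

Definition p_c (T : finType) (F : {set {set T}}) : R :=
  xget 0 [set p | is_critical F p]%classic.

Definition p_small (T : finType) (p : R) (F : {set {set T}}) : Prop :=
  exists G : {set {set T}}, covers G F /\ \sum_(S in G) p ^+ #|S| <= 2^-1.

Definition is_expectation_threshold (T : finType) (F : {set {set T}})
    (q : R) : Prop :=
  [/\ 0 <= q <= 1, p_small q F &
      forall p : R, 0 <= p <= 1 -> p_small p F -> p <= q].

Definition q_thr (T : finType) (F : {set {set T}}) : R :=
  xget 0 [set q | is_expectation_threshold F q]%classic.

Definition log2 (x : R) : R := ln x / ln 2.

Definition kahn_kalai_nontrivial (K : R) (X : nat -> finType)
    (F : forall n, {set {set X n}}) : Prop :=
  exists N : nat, forall n : nat, (N <= n)%N ->
    K * q_thr (F n) * log2 (ell (F n))%:R < 1.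

End Thresholds.

Arguments p_c {R T} F.
Arguments q_thr {R T} F.

(* The values selected by [xget] in [p_c] and [q_thr] exist. *)

Lemma p_cP (R : realType) (T : finType) (F : {set {set T}}) :
  upper_set F -> nontrivial F -> is_critical F (p_c F : R).
Proof.
move=> upF [F0 FT]; apply: (@xgetPex _ _ [set p | is_critical F p]%classic).
have F_T : setT \in F.
  have /set0Pn [A AF] : F != set0 by apply/eqP.
  exact: upF AF (finset.subsetT A).
have F_0 : set0 \notin F.
  apply/negP => h; apply: FT; apply/setP => A; rewrite inE.
  exact: upF h (sub0set A).
pose P : {poly R} := \sum_(S in F) 'X ^+ #|S| * (1 - 'X) ^+ (#|T| - #|S|).
have PE x : P.[x] = mu x F.
  by rewrite horner_sum; apply: eq_bigr => S _; rewrite !hornerE.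
have P0 : P.[0] = 0.
  rewrite PE /mu big1 // => S SF; rewrite expr0n cards_eq0.
  by case: eqP SF => [->|_ _]; rewrite ?(negPf F_0) ?mul0r.
have P1 : P.[1] = 1.
  rewrite PE /mu (bigD1 setT) //= big1 ?addr0.
    by rewrite cardsT subnn expr1n mulr1.
  move=> S /andP [_ ST]; rewrite subrr expr0n subn_eq0 -cardsT.
  case: leqP => [h|_]; last by rewrite mulr0.
  by case/negP: ST; rewrite eqEcard subsetT.
have cP : ({within `[0, 1]%classic, continuous (horner P)})%classic.
  exact/continuous_subspaceT/continuous_horner.
have [|c] := @IVT R (horner P) 0 1 2^-1 ler01 cP.
  rewrite P0 P1 ge_min le_max invr_ge0 ler0n /= invf_le1 ?ltr0n //.
  by rewrite (ler_nat _ 1 2) orbT.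
by rewrite in_itv /= => c01 Pc; exists c; split=> //; rewrite -PE.
Qed.

Lemma q_thrP (R : realType) (T : finType) (F : {set {set T}}) :
  upper_set F -> nontrivial F -> is_expectation_threshold F (q_thr F : R).
Proof.
move=> upF [F0 FT].
apply: (@xgetPex _ _ [set q | is_expectation_threshold F q]%classic).
have F_0 : set0 \notin F.
  apply/negP => h; apply: FT; apply/setP => A; rewrite inE.
  exact: upF h (sub0set A).
pose f (G : {set {set T}}) (p : R) := \sum_(S in G) p ^+ #|S|.
pose C (G : {set {set T}}) :=
  ([set p : R | covers G F /\ f G p <= 2^-1])%classic.
have clC G : closed (C G).
  case: (pselect (covers G F)) => [cG|ncG]; last first.
    have -> : C G = classical_sets.set0 by apply/seteqP; split=> p // -[].
    exact: closed0.
  pose P : {poly R} := \sum_(S in G) 'X ^+ #|S|.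
  have fE p : f G p = P.[p].
    by rewrite horner_sum; apply: eq_bigr => S _; rewrite !hornerE.
  rewrite (_ : C G = horner P @^-1` [set x | x <= 2^-1])%classic; last first.
    by apply/seteqP; split=> p /=; rewrite /C /= fE => // -[].
  apply: preimage_closed; last exact: closed_le.
  by move=> x _; exact: continuous_horner.
pose A := (`[0, 1] `&` classical_sets.bigcup classical_sets.setT C)%classic.
have AP p : A p <-> 0 <= p <= 1 /\ p_small p F.
  rewrite /A; split=> [[/= + [G _ [cG fG]]]|[p01 [G [cG fG]]]].
    by rewrite in_itv /= => ->; split=> //; exists G.
  by split; [rewrite /= in_itv | exists G].
have cA : compact A.
  apply: (subclosed_compact _ (@segment_compact R 0 1)).
    apply: closedI; first exact: itv_closed.
    apply: closed_bigcup => [|G _]; last exact: clC.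
    exact: cardinality.finite_finset.
  exact: classical_sets.subIsetl.
have A0 : (A !=set0)%classic.
  exists 0; apply/AP; split; first by rewrite lexx ler01.
  exists F; split.
    apply/fintype.subsetP => S SF; apply/bigcupP; exists S => //.
    by rewrite inE.
  rewrite big1 ?invr_ge0 ?ler0n // => S SF; rewrite expr0n cards_eq0.
  by case: eqP SF => // ->; rewrite (negPf F_0).
have cid : ({within A, continuous (fun x : R => x)})%classic.
  by apply: continuous_subspaceT => x; exact: cvg_id.
have [q qA qmax] := compact_EVT_max A0 cA cid.
have /AP [q01 sq] : A q by rewrite -in_setE.
exists q; split=> // p p01 sp; apply: qmax.
by rewrite in_setE; apply/AP.
Qed.

(* Main.v *)
(* If x lies in all but t of the minimal elements of F, then {x} together with
   the t exceptional minimal elements is a cover of F by t + 1 nonempty sets, so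
   q(F) >= 1 / (2 (t + 1)). As q(F_n) < 1 / (K log (ell F_n)) tends to 0, this
   happens for finitely many n only. *)
Require Import Defs.
From mathcomp Require Import all_boot all_order all_algebra.
From mathcomp Require Import boolp classical_sets reals topology normedtype.
From mathcomp Require Import sequences derive exp.
From mathcomp Require Import finset.
From mathcomp Require Import zify.

Set Implicit Arguments.
Unset Strict Implicit.
Unset Printing Implicit Defensive.

Import Order.TTheory GRing.Theory Num.Theory.
Import numFieldNormedType.Exports.

Local Open Scope ring_scope.

Lemma nontrivial_set0 (T : finType) (F : {set {set T}}) :
  upper_set F -> nontrivial F -> set0 \notin F.
Proof.
move=> upF [_ FT]; apply/negP => F0; apply: FT; apply/setP => A.
by rewrite inE; exact: upF F0 (sub0set A).
Qed.

Lemma minimal_below (T : finType) (F : {set {set T}}) (A : {set T}) :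
  A \in F -> exists2 S, S \in minimals F & S \subset A.
Proof.
move=> AF; have [S minS SA] := @minset_exists _ (mem F) A AF.
by exists S; rewrite // inE.
Qed.

(** At [p = 1 / (2 (k + 1))] a nonempty member of [G] has weight at most [p], so [G] has total
    weight at most [(k + 1) p = 1/2] and witnesses that [F] is [p]-small; maximality of the
    threshold concludes. *)
Lemma q_thr_ge_cover (R : realType) (T : finType) (F G : {set {set T}})
    (k : nat) :
  upper_set F -> nontrivial F -> covers G F -> set0 \notin G ->
  (#|G| <= k.+1)%N -> (2 * k.+1%:R)^-1 <= q_thr F :> R.
Proof.
move=> upF ntF cGF G0 Gk; have [_ _] := q_thrP R upF ntF; apply.
  rewrite invr_ge0 mulr_ge0 ?ler0n //= invf_le1 ?mulr_gt0 ?ltr0n //.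
  by rewrite -natrM ler1n muln_gt0.
set p := _^-1; exists G; split=> //.
have p_ge0 : 0 <= p by rewrite invr_ge0 mulr_ge0 ?ler0n.
have p_le1 : p <= 1.
  by rewrite invf_le1 ?mulr_gt0 ?ltr0n // -natrM ler1n muln_gt0.
apply: (@le_trans _ _ (\sum_(S in G) p)).
  apply: ler_sum => S SG; rewrite -[leRHS]expr1; apply: ler_wiXn2l => //.
  by rewrite card_gt0; apply: contraNneq G0 => <-.
rewrite sumr_const -(mulr_natr p) (@le_trans _ _ (p * k.+1%:R)) //.
  by rewrite ler_wpM2l // ler_nat.
by rewrite /p invfM -mulrA mulVf ?mulr1 // pnatr_eq0.
Qed.

Lemma q_thr_ge_sigma (R : realType) (T : finType) (F : {set {set T}})
    (t : nat) :
  upper_set F -> nontrivial F ->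
  sigma (#|minimals F|%:Z - t%:Z)
        (fun i : 'I_#|minimals F| => enum_val i) != set0 ->
  (2 * t.+1%:R)^-1 <= q_thr F :> R.
Proof.
move=> upF ntF /set0Pn [x /bigcupP [I /eqP cardI /bigcapP xI]].
(* The index is an integer, so [#|I| = #|minimals F| - t] holds without truncation and forces
   [t <= #|minimals F|]. *)
have cardCI : #|~: I| = t.
  by have := cardsC I; rewrite card_ord; lia.
apply: (@q_thr_ge_cover _ _ _ ([set x] |: [set enum_val i | i in ~: I])) => //.
- apply/fintype.subsetP => A /minimal_below [S Smin SA].
  pose i := enum_rank_in Smin S.
  have iS : enum_val i = S by rewrite enum_rankK_in.
  (* If [S] is indexed by [I], it contains [x], hence so does [A]; otherwise [S] is itself in the
     cover. *)
  apply/bigcupP; have [iI|iI] := boolP (i \in I).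
    exists [set x]; first by rewrite !inE eqxx.
    by rewrite inE sub1set (fintype.subsetP SA) // -iS xI.
  exists S; last by rewrite inE.
  by rewrite inE -iS imset_f ?orbT // inE.
- rewrite !inE negb_or; apply/andP; split.
    by rewrite eq_sym -card_gt0 cards1.
  (* The exceptional sets belong to [F], which omits [set0]. *)
  apply: contra (nontrivial_set0 upF ntF) => /imsetP [i _ ->].
  by have := enum_valP i; rewrite inE => /minsetp.
(* Only an upper bound is needed: [[set x]] may coincide with an exceptional set. *)
- by rewrite cardsU1 -add1n leq_add ?leq_b1 // -cardCI leq_imset_card.
Qed.

Lemma log2_cvg_pinfty (R : realType) (u : nat -> nat) (M : R) :
  (u n @[n --> \oo] --> \oo)%classic ->
  exists N : nat, forall n : nat, (N <= n)%N -> M <= log2 (u n)%:R.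
Proof.
(* [B] is an integer above [2 ^ M], written [expR (M * ln 2)] since [M] is real. *)
move=> u_oo; pose B := (Num.truncn (expR (M * ln 2))).+1.
have ln2_gt0 : 0 < ln 2 :> R by rewrite ln_gt0 // ltr1n.
have [N _ uN] := u_oo _ (nbhs_infty_ge B).
exists N => n Nn; have /= Bu := uN n Nn.
have e_lt : expR (M * ln 2) <= (u n)%:R.
  by rewrite (le_trans (ltW (truncnS_gt _))) // ler_nat.
rewrite /log2 ler_pdivlMr // -[leLHS]expRK ler_ln // posrE ?expR_gt0 //.
exact: lt_le_trans (expR_gt0 _) e_lt.
Qed.

Theorem corollary5p9 (R : realType) (X : nat -> finType)
    (F : forall n : nat, {set {set X n}})
    (F_upper : forall n : nat, upper_set (F n))
    (F_nontrivial : forall n : nat, nontrivial (F n))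
    (K : R) (K_gt0 : 0 < K)
    (kahn_kalai : forall n : nat,
       p_c (F n) <= K * q_thr (F n) * log2 (ell (F n))%:R)
    (ell_oo : (ell (F n) @[n --> \oo] --> \oo)%classic)
    (info : kahn_kalai_nontrivial K F) :
  forall t : nat, exists N : nat, forall n : nat, (N <= n)%N ->
    sigma (#|minimals (F n)|%:Z - t%:Z)
          (fun i : 'I_#|minimals (F n)| => enum_val i) = set0.
Proof.
move=> t; have [N1 infoN1] := info.
(* This bound on the logarithm is the inverse of [K / (2 (t + 1))], the lower bound for
   [K * q_thr (F n)] when [sigma] is nonempty; the product is then at least 1, against [info]. *)
have [N2 logN2] := log2_cvg_pinfty (2 * t.+1%:R / K) ell_oo.
exists (maxn N1 N2) => n; rewrite geq_max => /andP [N1n N2n].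
apply/eqP; apply/negPn/negP.
move=> /(q_thr_ge_sigma R (F_upper n) (F_nontrivial n)) q_ge.
have := infoN1 n N1n; rewrite ltNge => /negP; apply.
have c_gt0 : 0 < 2 * t.+1%:R :> R by rewrite mulr_gt0 ?ltr0n.
rewrite [leLHS](_ : 1 = K / (2 * t.+1%:R) * (2 * t.+1%:R / K)); last first.
  by rewrite mulrA mulfVK ?gt_eqF // mulfV ?gt_eqF.
apply: ler_pM; last exact: logN2.
- by rewrite mulr_ge0 ?invr_ge0 ?ltW.
- by rewrite divr_ge0 ?ltW.
- by rewrite ler_wpM2l // ltW.
Qed.
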